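(* Let $C=(c_{n,k}(q))_{n,k\ge0}$ be defined by $c_{0,0}(q)=1$, $c_{n,k}(q)=0$ unless $n\ge k\ge 0$, and, for $n\ge1$, one of the following two recurrences: (1) for some real numbers $f\ge e\ge 0$, $c_{n,0}(q)=[(f-e)+eq]\,c_{n-1,0}(q)+fq\,c_{n-1,1}(q)$ and $c_{n,k}(q)=c_{n-1,k-1}(q)+(1+q)\,c_{n-1,k}(q)+q\,c_{n-1,k+1}(q)$ for $k\ge1$; (2) for some real numbers $e,f\ge1$, $c_{n,0}(q)=[(f-1)+eq]\,c_{n-1,0}(q)+efq\,c_{n-1,1}(q)$ and $c_{n,k}(q)=c_{n-1,k-1}(q)+(1+eq)\,c_{n-1,k}(q)+eq\,c_{n-1,k+1}(q)$ for $k\ge1$. Then the Hankel matrix $(c_{i+j,0}(q))_{i,j\ge0}$ is $q$-totally positive.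
   Context: A matrix whose entries are polynomials in $q$ is called $q$-totally positive if every minor (determinant of a finite square submatrix) has all coefficients nonnegative. *)

(* Defs.v *)
From HB Require Import structures.
From mathcomp Require Import all_boot all_order all_algebra.
From mathcomp Require Import reals.
Set Implicit Arguments.
Unset Strict Implicit.
Unset Printing Implicit Defensive.

Import Order.TTheory GRing.Theory Num.Theory.
Local Open Scope ring_scope.

Definition strictly_increasing (m : nat) (r : 'I_m -> nat) : Prop :=
  forall i j : 'I_m, (i < j)%N -> (r i < r j)%N.

(* Polynomials in q are elements of {poly R}, with q := 'X.  Infinite matrices
   are functions nat -> nat -> {poly R}; the m x m submatrix on rows r and
   columns c is given by the increasing enumerations of its index sets. *)
Definition q_totally_positive (R : realType) (M : nat -> nat -> {poly R})
    : Prop :=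
  forall (m : nat) (r c : 'I_m -> nat),
    strictly_increasing r -> strictly_increasing c ->
    forall d : nat, 0 <= (\det (\matrix_(i < m, j < m) M (r i) (c j)))`_d.

Definition recurrence1 (R : realType) (e f : R) (c : nat -> nat -> {poly R})
    : Prop :=
  (forall n, c n.+1 0%N =
     ((f - e)%:P + e *: 'X) * c n 0%N + (f *: 'X) * c n 1%N) /\
  (forall n k, c n.+1 k.+1 =
     c n k + (1 + 'X) * c n k.+1 + 'X * c n k.+2).

Definition recurrence2 (R : realType) (e f : R) (c : nat -> nat -> {poly R})
    : Prop :=
  (forall n, c n.+1 0%N =
     ((f - 1)%:P + e *: 'X) * c n 0%N + ((e * f) *: 'X) * c n 1%N) /\
  (forall n k, c n.+1 k.+1 =
     c n k + (1 + e *: 'X) * c n k.+1 + (e *: 'X) * c n k.+2).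

(* Main.v *)
(** Both recurrences are the case [a, e, x >= 0] of
      c_(n+1,0) = (a + e x) c_(n,0) + (a + e) x c_(n,1),
      c_(n+1,k) = c_(n,k-1) + (1 + x) c_(n,k) + x c_(n,k+1),
    with [(a, e, x)] equal to [(f - e, e, q)] or [(f - 1, 1, e q)].  The minors
    of the tridiagonal coefficient matrix [J] split into consecutive principal
    ones; writing [M_k] for a principal minor starting at index [k > 0], the
    continuant recurrence preserves [M_k >= M_(k+1)] and [M_k >= x M_(k+1)]
    coefficientwise, and a minor starting at index [0] equals
    [a (M_1 - x M_2) + e x (M_1 - M_2)].  Since row [n+1] of [C] is row [n]
    times [J], Cauchy-Binet makes [C] totally positive, and then also the Hankel
    matrix, which is [C D C^T] with [D] the diagonal matrix of the products of
    the subdiagonal entries of [J]. *)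
Require Import Defs.
From HB Require Import structures.
From mathcomp Require Import all_boot all_order all_algebra.
From mathcomp Require Import fingroup perm ring zify.
From mathcomp Require Import reals.
Set Implicit Arguments.
Unset Strict Implicit.
Unset Printing Implicit Defensive.

Import Order.TTheory GRing.Theory Num.Theory.
Local Open Scope ring_scope.

Definition minor (K : comNzRingType) (M : nat -> nat -> K) (m : nat)
    (r c : 'I_m -> nat) : K :=
  \det (\matrix_(i < m, j < m) M (r i) (c j)).

(** * Cauchy-Binet and expansions of determinants *)

Section Determinants.
Variable K : comNzRingType.

Lemma det_rowsub_perm m n (B : 'M[K]_(n, m)) (f : 'I_m -> 'I_n) (s : 'S_m) :
  \det (rowsub (f \o s) B) = (-1) ^+ s * \det (rowsub f B).
Proof.
rewrite -det_perm -det_mulmx -row_permE; congr (\det _).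
by apply/matrixP => i j; rewrite !mxE.
Qed.

Lemma det_colsub_perm m n (A : 'M[K]_(m, n)) (f : 'I_m -> 'I_n) (s : 'S_m) :
  \det (colsub (f \o s) A) = (-1) ^+ s * \det (colsub f A).
Proof.
have E (g : 'I_m -> 'I_n) : \det (colsub g A) = \det (rowsub g A^T).
  by rewrite -det_tr; congr (\det _); apply/matrixP => i j; rewrite !mxE.
by rewrite !E det_rowsub_perm.
Qed.

Lemma det_mulmx_rows m n (A : 'M[K]_(m, n)) (B : 'M[K]_(n, m)) :
  \det (A *m B) =
  \sum_(f : {ffun 'I_m -> 'I_n}) (\prod_i A i (f i)) * \det (rowsub f B).
Proof.
transitivity (\sum_(f : {ffun 'I_m -> 'I_n}) \sum_(s : 'S_m)
    (-1) ^+ s * \prod_i (A i (f i) * B (f i) (s i))).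
  rewrite exchange_big; apply: eq_bigr => s _; rewrite -big_distrr /=.
  rewrite -(bigA_distr_bigA (fun i k => A i k * B k (s i))).
  by congr (_ * _); apply: eq_bigr => i _; rewrite mxE.
apply: eq_bigr => f _; rewrite big_distrr; apply: eq_bigr => s _ /=.
rewrite big_split mulrCA; congr (_ * (_ * _)).
by apply: eq_bigr => i _; rewrite !mxE.
Qed.

(* The Cauchy-Binet formula with the sum over all maps instead of the
   increasing ones, whence the factor [m`!]. *)
Lemma cauchy_binet_sym m n (A : 'M[K]_(m, n)) (B : 'M[K]_(n, m)) :
  \det (A *m B) *+ m`! =
  \sum_(f : {ffun 'I_m -> 'I_n}) \det (colsub f A) * \det (rowsub f B).
Proof.
transitivity (\sum_(s : 'S_m) \det (A *m B)).
  by rewrite sumr_const -card_Sn; congr (_ *+ _); apply: eq_card.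
under [RHS]eq_bigr do rewrite big_distrl.
rewrite [RHS]exchange_big /=; apply: eq_bigr => s _.
pose h (t : 'S_m) (f : {ffun 'I_m -> 'I_n}) := [ffun i => f (t i)].
have hK (t : 'S_m) : cancel (h t) (h t^-1)%g.
  by move=> f; apply/ffunP => i; rewrite !ffunE permKV.
(* Replacing [f] by [f \o s^-1] undoes [s] in the entries of [A] and creates a second sign in the
   minor of [B], which cancels the first. Each [s] thus contributes one copy of [\det (A *m B)]. *)
rewrite (reindex_inj (can_inj (hK s^-1%g))) det_mulmx_rows.
apply: eq_bigr => f _ /=.
have -> : rowsub (h s^-1%g f) B = rowsub (f \o s^-1%g) B.
  by apply/matrixP => i j; rewrite !mxE ffunE.
rewrite det_rowsub_perm odd_permV mulrCA !mulrA -signr_addb addbb mul1r.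
by congr (_ * _); apply: eq_bigr => i _; rewrite mxE ffunE permK.
Qed.

Lemma det_row0 m (A : 'M[K]_m.+1) :
  (forall j, j != ord0 -> A ord0 j = 0) ->
  \det A = A ord0 ord0 * \det (row' ord0 (col' ord0 A)).
Proof.
move=> A0; rewrite (expand_det_row A ord0) (bigD1 ord0) //= big1 => [|j /A0->].
  by rewrite addr0 /cofactor expr0 mul1r.
by rewrite mul0r.
Qed.

Lemma det_col0 m (A : 'M[K]_m.+1) :
  (forall i, i != ord0 -> A i ord0 = 0) ->
  \det A = A ord0 ord0 * \det (row' ord0 (col' ord0 A)).
Proof.
move=> A0; rewrite (expand_det_col A ord0) (bigD1 ord0) //= big1 => [|j /A0->].
  by rewrite addr0 /cofactor expr0 mul1r.
by rewrite mul0r.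
Qed.

Section Minors.
Variable M : nat -> nat -> K.

Local Notation tl r := (r \o lift ord0).

Lemma minor_tl m (r c : 'I_m.+1 -> nat) :
  \det (row' ord0 (col' ord0 (\matrix_(i, j) M (r i) (c j)))) =
  minor M (tl r) (tl c).
Proof. by congr (\det _); apply/matrixP => i j; rewrite !mxE. Qed.

Lemma minor_row0 m (r c : 'I_m.+1 -> nat) :
  (forall j, j != ord0 -> M (r ord0) (c j) = 0) ->
  minor M r c = M (r ord0) (c ord0) * minor M (tl r) (tl c).
Proof.
move=> M0; rewrite /minor det_row0 ?minor_tl ?mxE // => j /M0.
by rewrite mxE.
Qed.

Lemma minor_col0 m (r c : 'I_m.+1 -> nat) :
  (forall i, i != ord0 -> M (r i) (c ord0) = 0) ->
  minor M r c = M (r ord0) (c ord0) * minor M (tl r) (tl c).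
Proof.
move=> M0; rewrite /minor det_col0 ?minor_tl ?mxE // => j /M0.
by rewrite mxE.
Qed.

(** Expansion along the first row leaves two terms; the cofactor of the second is then expanded
    along its first column, where one entry survives. *)
Lemma minor_continuant m (r c : 'I_m.+2 -> nat) :
  (forall j : 'I_m.+2, (1 < j)%N -> M (r ord0) (c j) = 0) ->
  (forall i : 'I_m.+2, (1 < i)%N -> M (r i) (c ord0) = 0) ->
  let o := lift ord0 ord0 in
  minor M r c = M (r ord0) (c ord0) * minor M (tl r) (tl c)
    - M (r ord0) (c o) * M (r o) (c ord0) * minor M (tl (tl r)) (tl (tl c)).
Proof.
move=> Mr Mc o; rewrite /minor (expand_det_row _ ord0) big_ord_recl.
rewrite big_ord_recl big1 ?addr0 => [|j _]; last by rewrite !mxE Mr ?mul0r.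
rewrite /cofactor minor_tl !mxE /= expr0 expr1 !mul1r; congr (_ + _).
rewrite det_col0 => [|i]; last first.
  rewrite -val_eqE !mxE => /= i0.
  have -> : lift (lift ord0 ord0) (ord0 : 'I_m.+1) = ord0 :> 'I_m.+2.
    exact: val_inj.
  by apply: Mc; rewrite lift0 ltnS lt0n.
rewrite !mxE mulN1r mulrN mulrA; congr (- (_ * _ * _)).
  by congr (M _ (c _)); apply: val_inj.
congr (\det _); apply/matrixP => i j; rewrite !mxE /=; congr (M (r _) (c _)).
exact: val_inj.
Qed.

End Minors.
End Determinants.

(** Serves to replace the injective maps in the Cauchy-Binet sum by increasing ones. *)
Lemma sorting_perm m (g : 'I_m -> nat) :
  injective g -> exists s : 'S_m, strictly_increasing (g \o s).
Proof.
move=> g_inj; pose t := [tuple g i | i < m].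
have /tuple_permP [s us] : perm_eq (sort leq t) t by rewrite perm_sort.
have srt : sorted ltn (sort leq t).
  rewrite ltn_sorted_uniq_leq sort_uniq map_inj_uniq ?enum_uniq //.
  by apply: sort_sorted; apply: leq_total.
exists s => i j ij /=.
have E k : g (s k) = nth 0%N (sort leq t) k.
  by rewrite us -tnth_nth !tnth_mktuple.
rewrite !E; apply: (sorted_ltn_nth ltn_trans) => //.
  by rewrite inE size_sort size_tuple.
by rewrite inE size_sort size_tuple.
Qed.

Lemma strictly_increasing_tl m (r : 'I_m.+1 -> nat) :
  strictly_increasing r -> strictly_increasing (r \o lift ord0).
Proof. by move=> ri i j ij; apply: ri; rewrite !lift0. Qed.

Lemma strictly_increasing_neq0 m (r : 'I_m.+1 -> nat) (j : 'I_m.+1) :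
  strictly_increasing r -> j != ord0 -> (r ord0 < r j)%N.
Proof. by move=> ri; rewrite -val_eqE /= -lt0n => j0; apply: ri. Qed.

(** * Minors of a tridiagonal matrix *)

Section Tridiagonal.
Variables (K : comNzRingType) (M : nat -> nat -> K).
Hypothesis band : forall i j, (i.+1 < j)%N || (j.+1 < i)%N -> M i j = 0.

Local Notation tl r := (r \o lift ord0).

(** The smaller of the two first indices is at distance at least two from all later indices on the
    other side, so its row or column has a single entry left. *)
Lemma tridiag_minor_neq m (r c : 'I_m.+1 -> nat) :
  strictly_increasing r -> strictly_increasing c -> r ord0 <> c ord0 ->
  minor M r c = M (r ord0) (c ord0) * minor M (tl r) (tl c).
Proof.
move=> ri ci /eqP; rewrite neq_ltn => /orP[lt0 | lt0].
  apply: minor_row0 => j /(strictly_increasing_neq0 ci) lt1.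
  by apply: band; rewrite (leq_ltn_trans lt0 lt1).
apply: minor_col0 => j /(strictly_increasing_neq0 ri) lt1.
by apply: band; rewrite (leq_ltn_trans lt0 lt1) orbT.
Qed.

(** If the rows skip [k.+1], the first column is zero below the diagonal, and symmetrically for the
    columns; otherwise the continuant recurrence applies. *)
Lemma tridiag_minor_eq m (r c : 'I_m.+2 -> nat) k :
  strictly_increasing r -> strictly_increasing c ->
  r ord0 = k -> c ord0 = k ->
  minor M r c = M k k * minor M (tl r) (tl c) \/
  [/\ tl r ord0 = k.+1, tl c ord0 = k.+1 & minor M r c =
     M k k * minor M (tl r) (tl c)
     - M k k.+1 * M k.+1 k * minor M (tl (tl r)) (tl (tl c))].
Proof.
move=> ri ci r0 c0; have o0 : lift ord0 ord0 != ord0 :> 'I_m.+2 by [].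
have gt1 (g : 'I_m.+2 -> nat) (j : 'I_m.+2) : strictly_increasing g ->
    (1 < j)%N -> (g (lift ord0 ord0) < g j)%N.
  by move=> gi j1; apply: gi.
have := strictly_increasing_neq0 ri o0; rewrite r0 leq_eqVlt => /predU1P[r1|r1];
  last first.
  left; rewrite minor_col0 ?r0 ?c0 // => i; rewrite -val_eqE /= => i0.
  apply/band/orP; right; apply: leq_trans r1 _.
  case: (ltngtP 1 i) => [/(gt1 r i ri)/ltnW // | | i1].
    by case: (val i) i0.
  by apply/eq_leq; congr (r _); apply: val_inj.
have := strictly_increasing_neq0 ci o0; rewrite c0 leq_eqVlt => /predU1P[c1|c1];
  last first.
  left; rewrite minor_row0 ?r0 ?c0 // => i; rewrite -val_eqE /= => i0.
  apply/band/orP; left; apply: leq_trans c1 _.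
  case: (ltngtP 1 i) => [/(gt1 c i ci)/ltnW // | | i1].
    by case: (val i) i0.
  by apply/eq_leq; congr (c _); apply: val_inj.
right; split=> //; rewrite minor_continuant.
- by rewrite r0 c0 -r1 -c1.
- by move=> j /(gt1 c j ci); rewrite -c1 => lt1; rewrite r0 band ?lt1.
by move=> j /(gt1 r j ri); rewrite -r1 => lt1; rewrite c0 band ?lt1 ?orbT.
Qed.

End Tridiagonal.

(** * Coefficientwise nonnegativity of minors *)

Section Positivity.
Variable R : realDomainType.

Local Notation nnegp := (polyOver (@Num.Def.nneg_num_pred R)).

Lemma nnegp_mulrn (p : {poly R}) n :
  (0 < n)%N -> p *+ n \is a nnegp -> p \is a nnegp.
Proof.
move=> n0 /polyOverP pn; apply/polyOverP => d; move: (pn d).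
by rewrite coefMn !nnegrE pmulrn_lge0.
Qed.

Lemma minor_mul_nneg (A B M : nat -> nat -> {poly R}) N m (r c : 'I_m -> nat) :
  (forall k, strictly_increasing k -> minor A r k \is a nnegp) ->
  (forall k, strictly_increasing k -> minor B k c \is a nnegp) ->
  (forall i j, M (r i) (c j) = \sum_(k < N) A (r i) k * B k (c j)) ->
  minor M r c \is a nnegp.
Proof.
move=> A_nneg B_nneg Mdef.
pose A' := \matrix_(i < m, k < N) A (r i) k.
pose B' := \matrix_(k < N, j < m) B k (c j).
have -> : minor M r c = \det (A' *m B').
  congr (\det _); apply/matrixP => i j; rewrite !mxE Mdef.
  by apply: eq_bigr => k _; rewrite !mxE.
apply: (nnegp_mulrn (fact_gt0 m)); rewrite cauchy_binet_sym.
apply: rpred_sum => f _; have [f_inj | /injectivePn] := boolP (injectiveb f).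
  have g_inj : injective (val \o f).
    by apply: inj_comp val_inj (injectiveP _ f_inj).
  have [s fs_incr] := sorting_perm g_inj.
  have -> : \det (colsub f A') * \det (rowsub f B') =
            \det (colsub (f \o s) A') * \det (rowsub (f \o s) B').
    rewrite det_colsub_perm det_rowsub_perm mulrACA -signr_addb addbb.
    by rewrite mul1r.
  apply: rpredM.
    have -> : colsub (f \o s) A' = \matrix_(i, j) A (r i) (f (s j)).
      by apply/matrixP => i j; rewrite !mxE.
    exact: A_nneg fs_incr.
  have -> : rowsub (f \o s) B' = \matrix_(i, j) B (f (s i)) (c j).
    by apply/matrixP => i j; rewrite !mxE.
  exact: B_nneg fs_incr.
case=> i [j ij fij].
suff -> : \det (rowsub f B') = 0 by rewrite mulr0 rpred0.
by apply: (determinant_alternate ij) => k; rewrite !mxE fij.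
Qed.

(** * Total positivity of the coefficient matrix *)

Section Jacobi.
Variables a e x : {poly R}.
Hypotheses (a_nneg : a \is a nnegp) (e_nneg : e \is a nnegp)
  (x_nneg : x \is a nnegp).

Definition jacobi (i j : nat) : {poly R} :=
  if j is j'.+1 then
    (i == j')%:R + (1 + x) * (i == j)%:R + x * (i == j.+1)%:R
  else (a + e * x) * (i == 0)%:R + (a + e) * x * (i == 1)%:R.

Local Notation tl r := (r \o lift ord0).
Local Notation J := jacobi.

Lemma jacobi_band i j : (i.+1 < j)%N || (j.+1 < i)%N -> J i j = 0.
Proof.
case: j => [|j] /= lt_ij.
  have /negPf-> : i != 0%N by lia.
  have /negPf-> : i != 1%N by lia.
  by rewrite !mulr0 addr0.
have /negPf-> : i != j by lia.
have /negPf-> : i != j.+1 by lia.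
have /negPf-> : i != j.+2 by lia.
by rewrite !mulr0 !addr0.
Qed.

Lemma jacobi_nneg i j : J i j \is a nnegp.
Proof.
by case: j => [|j] /=; rewrite ?(rpredD, rpredM, rpred_nat, rpred1).
Qed.

Lemma jacobi_diag k : J k.+1 k.+1 = 1 + x.
Proof.
by rewrite /jacobi (gtn_eqF (ltnSn k)) eqxx (ltn_eqF (ltnSn k.+1)) /=; ring.
Qed.

Lemma jacobi_sup k : J k.+1 k.+2 = 1.
Proof.
rewrite /jacobi eqxx (ltn_eqF (ltnSn k.+1)) (@ltn_eqF k.+1 k.+3) //=; ring.
Qed.

Lemma jacobi_sub k : J k.+2 k.+1 = x.
Proof.
rewrite /jacobi eqxx (gtn_eqF (ltnSn k.+1)) (@gtn_eqF k k.+2) //=; ring.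
Qed.

Definition jacobi_minors_nneg m := forall r c : 'I_m -> nat,
  strictly_increasing r -> strictly_increasing c -> minor J r c \is a nnegp.

(* Along a principal run starting at an index [k > 0] these differences satisfy
   [d_k = d_(k+1)] and [d_k = x * d_(k+1)] respectively, so they stay
   nonnegative. *)
Definition jacobi_minors_decr m := forall (r c : 'I_m.+1 -> nat) k,
  strictly_increasing r -> strictly_increasing c ->
  r ord0 = k.+1 -> c ord0 = k.+1 ->
  minor J r c - x * minor J (tl r) (tl c) \is a nnegp /\
  minor J r c - minor J (tl r) (tl c) \is a nnegp.

(** The case of a principal run that stops at its first index, [p] being the minor on the remaining
    indices. *)
Lemma diag_decr (p : {poly R}) : p \is a nnegp ->
  (1 + x) * p - x * p \is a nnegp /\ (1 + x) * p - p \is a nnegp.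
Proof.
move=> p_nneg; have -> : (1 + x) * p - x * p = p by ring.
have -> : (1 + x) * p - p = x * p by ring.
by rewrite rpredM.
Qed.

Lemma jacobi_minors_decr_step m :
  jacobi_minors_nneg m.+1 -> jacobi_minors_decr m -> jacobi_minors_decr m.+1.
Proof.
move=> nneg decr r c k ri ci r0 c0.
have tri := strictly_increasing_tl ri; have tci := strictly_increasing_tl ci.
have [->|[r1 c1 ->]] := tridiag_minor_eq jacobi_band ri ci r0 c0.
  by rewrite jacobi_diag; apply/diag_decr/nneg.
have [dx d1] := decr _ _ _ tri tci r1 c1.
rewrite jacobi_diag jacobi_sup jacobi_sub; move: dx d1.
move: (minor J (tl r) (tl c)) (minor J (tl (tl r)) (tl (tl c))) => p q dx d1.
have -> : (1 + x) * p - 1 * x * q - x * p = p - x * q by ring.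
have -> : (1 + x) * p - 1 * x * q - p = x * (p - q) by ring.
by rewrite rpredM.
Qed.

Lemma jacobi_minors_nneg_step m :
  jacobi_minors_nneg m.+1 -> jacobi_minors_decr m -> jacobi_minors_nneg m.+2.
Proof.
move=> nneg decr r c ri ci; have decr1 := jacobi_minors_decr_step nneg decr.
have tri := strictly_increasing_tl ri; have tci := strictly_increasing_tl ci.
have [r0c0|/eqP ne0] := eqVneq (r ord0) (c ord0); last first.
  by rewrite (tridiag_minor_neq jacobi_band) // rpredM ?jacobi_nneg ?nneg.
case c0 : (c ord0) r0c0 => [|k] r0; last first.
  have [_ d1] := decr1 _ _ _ ri ci r0 c0.
  by rewrite -(subrK (minor J (tl r) (tl c)) (minor J r c)) rpredD ?nneg.
have [->|[r1 c1 ->]] := tridiag_minor_eq jacobi_band ri ci r0 c0.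
  by rewrite rpredM ?jacobi_nneg ?nneg.
have [dx d1] := decr _ _ _ tri tci r1 c1; move: dx d1.
move: (minor J (tl r) (tl c)) (minor J (tl (tl r)) (tl (tl c))) => p q dx d1.
(* Both indices start at 0: the common [a] and [e] in [J 0 0] and [J 1 0] let the two differences
   bounded by [decr] appear. *)
have -> : J 0 0 * p - J 0 1 * J 1 0 * q = a * (p - x * q) + e * x * (p - q).
  by rewrite /=; ring.
by rewrite rpredD ?rpredM.
Qed.

Lemma minor_ord1 (r c : 'I_1 -> nat) : minor J r c = J (r ord0) (c ord0).
Proof. by rewrite /minor det_mx11 mxE. Qed.

Lemma minor_ord0 (r c : 'I_0 -> nat) : minor J r c = 1.
Proof. exact: det_mx00. Qed.

Lemma jacobi_minor_nneg m : jacobi_minors_nneg m.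
Proof.
(* The continuant recurrence reaches two sizes back, so the induction carries two consecutive sizes
   and their comparison. *)
suff : jacobi_minors_nneg m /\ jacobi_minors_nneg m.+1 /\ jacobi_minors_decr m by case.
elim: m => [|m [_ [nneg decr]]].
  split; first by move=> r c _ _; rewrite minor_ord0 rpred1.
  split; first by move=> r c _ _; rewrite minor_ord1 jacobi_nneg.
  move=> r c k _ _ r0 c0.
  have -> : minor J r c = (1 + x) * 1.
    by rewrite minor_ord1 r0 c0 jacobi_diag mulr1.
  by rewrite minor_ord0; apply/diag_decr/rpred1.
split=> //; split; first exact: jacobi_minors_nneg_step.
exact: jacobi_minors_decr_step.
Qed.

(** Column [j] of [J] vanishes below row [j.+1], so truncation at [N] loses nothing. *)
Lemma sum_mul_jacobi N (v : nat -> {poly R}) j : (j.+1 < N)%N ->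
  \sum_(k < N) v k * J k j =
  if j is j'.+1 then v j' + (1 + x) * v j + x * v j.+1
  else (a + e * x) * v 0%N + (a + e) * x * v 1%N.
Proof.
move=> jN.
have pick l : (l < N)%N -> \sum_(k < N) v k * (k == l :> nat)%:R = v l.
  move=> lN; rewrite (bigD1 (Ordinal lN)) //= eqxx mulr1 big1 ?addr0 // => k.
  by rewrite -val_eqE /= => /negPf->; rewrite mulr0.
have pickM l (p : {poly R}) : (l < N)%N ->
    \sum_(k < N) v k * (p * (k == l :> nat)%:R) = p * v l.
  move=> lN; rewrite -[v l]pick // big_distrr; apply: eq_bigr => k _ /=.
  by rewrite mulrCA.
case: j jN => [|j] jN /=; under eq_bigr do rewrite !mulrDr.
  by rewrite big_split /= !pickM // ltnW.
by rewrite !big_split /= !pickM ?pick //; lia.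
Qed.

(** * Total positivity of the array [c] *)

Section CatalanLike.
Variable c : nat -> nat -> {poly R}.
Hypotheses (c00 : c 0%N 0%N = 1)
  (c_eq0 : forall n k : nat, (n < k)%N -> c n k = 0)
  (c_rec0 : forall n, c n.+1 0%N =
     (a + e * x) * c n 0%N + (a + e) * x * c n 1%N)
  (c_recS : forall n k, c n.+1 k.+1 =
     c n k + (1 + x) * c n k.+1 + x * c n k.+2).

Lemma catalan_row_succ N n j : (j.+1 < N)%N -> c n.+1 j = \sum_(k < N) c n k * J k j.
Proof. by move=> jN; rewrite sum_mul_jacobi //; case: j jN. Qed.

Lemma catalan_minor_succ n m (r k : 'I_m -> nat) :
  (forall (r k : 'I_m -> nat), strictly_increasing r -> strictly_increasing k ->
     (forall i, r i < n)%N -> minor c r k \is a nnegp) ->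
  strictly_increasing r -> strictly_increasing k ->
  (forall i, 0 < r i < n.+1)%N -> minor c r k \is a nnegp.
Proof.
move=> IH ri ki r_bd; pose r' i := (r i).-1.
have rE i : r i = (r' i).+1 by rewrite prednK //; case/andP: (r_bd i).
have r'i : strictly_increasing r' by move=> i j /ri; rewrite !rE.
pose M i j := c i.+1 j.
have -> : minor c r k = minor M r' k.
  by congr (\det _); apply/matrixP => i j; rewrite !mxE rE.
(* Large enough for [j.+1 < N] at every selected column [j]. *)
pose N := (\max_i k i).+2.
apply: (@minor_mul_nneg c J M N) => [l li|l li|i j].
- by apply: IH => // i; rewrite -ltnS -rE; case/andP: (r_bd i).
- exact: jacobi_minor_nneg.
by apply: catalan_row_succ; rewrite !ltnS leq_bigmax.
Qed.

(** Induction on a bound for the row indices. Positive rows are lowered by one through [J]; row 0 is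
    the first unit vector, so a minor using it is expanded along it and only positive rows
    remain. *)
Lemma catalan_minor_nneg m (r k : 'I_m -> nat) :
  strictly_increasing r -> strictly_increasing k -> minor c r k \is a nnegp.
Proof.
have [n] : exists n, forall i, (r i < n)%N.
  by exists (\max_i r i).+1 => i; rewrite ltnS leq_bigmax.
elim: n m r k => [|n IH] [|m] r k r_bd ri ki.
- by rewrite /minor det_mx00 rpred1.
- by have := r_bd ord0.
- by rewrite /minor det_mx00 rpred1.
have IH' l (r' k' : 'I_l -> nat) ri' ki' bd' := IH l r' k' bd' ri' ki'.
have [r0 | r0] := posnP (r ord0); last first.
  apply: (catalan_minor_succ (@IH' _)) => // i; rewrite r_bd andbT.
  have [->//|i0] := eqVneq i ord0.
  by apply: leq_ltn_trans (strictly_increasing_neq0 ri i0).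
have tri := strictly_increasing_tl ri; have tki := strictly_increasing_tl ki.
rewrite minor_row0 => [|j j0]; last first.
  by rewrite r0 c_eq0 // (leq_ltn_trans _ (strictly_increasing_neq0 ki j0)).
rewrite rpredM //; last first.
  apply: (catalan_minor_succ (@IH' _)) => // i; apply/andP; split; last exact: r_bd.
  by rewrite -r0; apply: strictly_increasing_neq0.
by rewrite r0; case: (k ord0) => [|l]; rewrite ?c00 ?rpred1 // c_eq0 // rpred0.
Qed.

(** * Factorization of the Hankel matrix *)

Definition weight (k : nat) : {poly R} :=
  if k is k'.+1 then (a + e) * x ^+ k else 1.

Lemma weight_nneg k : weight k \is a nnegp.
Proof. by case: k => [|k] /=; rewrite ?rpred1 // rpredM ?rpredD ?rpredX. Qed.

(** Since [J k l * weight l] is symmetric in [k] and [l], the sum telescopes to a boundary term, as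
    in a Christoffel-Darboux formula. *)
Lemma shift_defect N i j :
  \sum_(k < N.+1) weight k * (c i.+1 k * c j k - c i k * c j.+1 k) =
  weight N.+1 * (c i N.+1 * c j N - c i N * c j N.+1).
Proof.
elim: N => [|N IHN]; rewrite big_ord_recr /=.
  by rewrite big_ord0 !c_rec0; ring.
by rewrite IHN !c_recS /= !exprS; ring.
Qed.

(** Units are moved one at a time from [i] to [j], down to row 0, where only the term [k = 0] is
    left. *)
Lemma hankel_factor N i j : (i + j <= N)%N ->
  c (i + j)%N 0%N = \sum_(k < N.+1) c i k * (weight k * c j k).
Proof.
elim: i j => [|i IHi] j ijN.
  rewrite big_ord_recl c00 mul1r mul1r big1 ?addr0 // => k _.
  by rewrite c_eq0 ?mul0r.
rewrite addSnnS IHi ?addnS //; apply/esym/eqP; rewrite -subr_eq0 -sumrB.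
(* The boundary term is zero: column [N.+1] lies beyond the support of rows [i] and [j]. *)
rewrite -[X in _ == X](_ : weight N.+1 *
  (c i N.+1 * c j N - c i N * c j N.+1) = 0); last first.
  by rewrite !c_eq0 ?mul0r ?mulr0 ?subrr ?mulr0 //; lia.
by rewrite -shift_defect; apply/eqP/eq_bigr => k _; ring.
Qed.

Lemma hankel_minor_nneg m (r k : 'I_m -> nat) :
  strictly_increasing r -> strictly_increasing k ->
  minor (fun i j => c (i + j)%N 0%N) r k \is a nnegp.
Proof.
move=> ri ki; pose N := (\max_i r i + \max_i k i)%N.
pose B l j := weight l * c j l.
apply: (@minor_mul_nneg c B _ N.+1) => [l li|l li|i j].
- exact: catalan_minor_nneg.
(* The weights factor out of the rows, leaving a transposed minor of [c]. *)
- have -> : minor B l k = (\prod_i weight (l i)) * minor c k l.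
    rewrite -[minor c k l]det_tr /minor.
    transitivity (\det (diag_mx (\row_i weight (l i)) *m
                   (\matrix_(i < m, j < m) c (k i) (l j))^T)).
      by congr (\det _); apply/matrixP => i j; rewrite mul_diag_mx !mxE.
    rewrite det_mulmx det_diag; congr (_ * _).
    by apply: eq_bigr => i _; rewrite mxE.
  by rewrite rpredM ?catalan_minor_nneg // rpred_prod // => i _; apply: weight_nneg.
by apply: hankel_factor; rewrite leq_add ?leq_bigmax.
Qed.

End CatalanLike.
End Jacobi.
End Positivity.

Theorem theorem4p3 (R : realType) (c : nat -> nat -> {poly R})
    (c00 : c 0%N 0%N = 1)
    (c_eq0 : forall n k : nat, (n < k)%N -> c n k = 0)
    (c_rec :
       (exists e f : R, 0 <= e /\ e <= f /\ recurrence1 e f c) \/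
       (exists e f : R, 1 <= e /\ 1 <= f /\ recurrence2 e f c)) :
  q_totally_positive (fun i j : nat => c (i + j)%N 0%N).
Proof.
move=> m r k ri ki d.
suff /polyOverP/(_ d) : minor (fun i j => c (i + j)%N 0%N) r k
    \is a polyOver (@Num.Def.nneg_num_pred R) by [].
case: c_rec => -[e [f [e_ge [f_ge [rec0 recS]]]]].
  apply: (@hankel_minor_nneg R (f - e)%:P e%:P 'X) => //.
  - by rewrite polyOverC unfold_in /= subr_ge0.
  - by rewrite polyOverC.
  - exact: polyOverX.
  - by move=> n; rewrite rec0 -!mul_polyC -polyCD subrK.
(* With [x = e q], the sum of the first two parameters is [f], so the coefficient of [c n 1] becomes
   [e f q]. *)
apply: (@hankel_minor_nneg R (f - 1)%:P 1 (e *: 'X)) => //.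
- by rewrite polyOverC unfold_in /= subr_ge0.
- exact: rpred1.
- by rewrite -mul_polyC rpredM ?polyOverX // polyOverC; apply: le_trans e_ge.
- by move=> n; rewrite rec0 -!mul_polyC mul1r -polyCD subrK polyCM; ring.
Qed.
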